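(* Let $\widehat{a}_1,\widehat{a}_2,\widehat{b}_1$ be dual numbers with $\Re(\widehat{b}_1)\notin\{0,-1,-2,\dots\}$, and let $\widehat{x}$ be a dual number with $|\widehat{x}|<1$ and $\left|\frac{\widehat{x}}{1-\widehat{x}}\right|<1$. Then $${}_2F_1(\widehat{a}_1,\widehat{a}_2;\widehat{b}_1;\widehat{x})=(1-\widehat{x})^{-\widehat{a}_1}\,{}_2F_1\Bigl(\widehat{a}_1,\widehat{b}_1-\widehat{a}_2;\widehat{b}_1;\frac{-\widehat{x}}{1-\widehat{x}}\Bigr)$$ and $${}_2F_1(\widehat{a}_1,\widehat{a}_2;\widehat{b}_1;\widehat{x})=(1-\widehat{x})^{\widehat{b}_1-\widehat{a}_1-\widehat{a}_2}\,{}_2F_1(\widehat{b}_1-\widehat{a}_1,\widehat{b}_1-\widehat{a}_2;\widehat{b}_1;\widehat{x}).$$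
   Context: Dual numbers are $\widehat{x}=x_1+\varepsilon x_2$, $x_1,x_2\in\mathbb{R}$, $\varepsilon^2=0$, forming the commutative ring $\mathbb{R}[\varepsilon]/(\varepsilon^2)$; $\Re(\widehat{x})=x_1$, $|\widehat{x}|=|x_1|$, and division by $\widehat{x}$ is possible iff $x_1\ne0$. For $\widehat{y}=y_1+\varepsilon y_2$ with $y_1>0$ and $\widehat{c}=c_1+\varepsilon c_2$, $(\widehat{y})^{\widehat{c}}=y_1^{c_1}\bigl(1+\varepsilon(\frac{y_2c_1}{y_1}+c_2\log y_1)\bigr)$. The dual shifted factorial is $(\widehat{a})_0=1$, $(\widehat{a})_k=\widehat{a}(\widehat{a}+1)\cdots(\widehat{a}+k-1)$ for $k\ge1$, and the dual Gauss hypergeometric function is ${}_2F_1(\widehat{a}_1,\widehat{a}_2;\widehat{b}_1;\widehat{x})=\sum_{k=0}^\infty\frac{(\widehat{a}_1)_k(\widehat{a}_2)_k(\widehat{x})^k}{(\widehat{b}_1)_k\,k!}$, convergence being in real and dual parts. *)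

(* Defs.v *)
From HB Require Import structures.
From mathcomp Require Import all_boot all_order all_algebra.
From mathcomp Require Import ring.
From mathcomp Require Import all_classical all_reals all_analysis.
Set Implicit Arguments.
Unset Strict Implicit.
Unset Printing Implicit Defensive.
Import Order.TTheory GRing.Theory Num.Theory.
Import numFieldNormedType.Exports.
Local Open Scope classical_set_scope.
Local Open Scope ring_scope.

(* [DualNum x1 x2] is x1 + eps x2 (see [dualnumE]). *)
Record dualnum (R : Type) := DualNum { dre : R; ddu : R }.

Section DualChoice.
Variable R : choiceType.

Definition pair_of_dualnum (x : dualnum R) : R * R := (dre x, ddu x).
Definition dualnum_of_pair (p : R * R) : dualnum R := DualNum p.1 p.2.

Lemma pair_of_dualnumK : cancel pair_of_dualnum dualnum_of_pair.
Proof. by case. Qed.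

HB.instance Definition _ := Choice.copy (dualnum R) (can_type pair_of_dualnumK).
End DualChoice.

Section DualRing.
Variable R : comNzRingType.
Implicit Types x y z : dualnum R.

Definition dual_zero : dualnum R := DualNum 0 0.
Definition dual_one : dualnum R := DualNum 1 0.
Definition dual_opp x : dualnum R := DualNum (- dre x) (- ddu x).
Definition dual_add x y : dualnum R := DualNum (dre x + dre y) (ddu x + ddu y).
Definition dual_mul x y : dualnum R :=
  DualNum (dre x * dre y) (dre x * ddu y + ddu x * dre y).

Fact dual_addA : associative dual_add.
Proof. by move=> x y z; rewrite /dual_add /= !addrA. Qed.
Fact dual_addC : commutative dual_add.
Proof. by move=> x y; congr DualNum; rewrite addrC. Qed.
Fact dual_add0 : left_id dual_zero dual_add.
Proof. by case=> x1 x2; congr DualNum; rewrite add0r. Qed.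
Fact dual_addN : left_inverse dual_zero dual_opp dual_add.
Proof. by move=> x; congr DualNum; rewrite addNr. Qed.

HB.instance Definition _ :=
  GRing.isZmodule.Build (dualnum R) dual_addA dual_addC dual_add0 dual_addN.

Fact dual_mulA : associative dual_mul.
Proof. by move=> x y z; congr DualNum => /=; ring. Qed.
Fact dual_mulC : commutative dual_mul.
Proof. by move=> x y; congr DualNum => /=; ring. Qed.
Fact dual_mul1 : left_id dual_one dual_mul.
Proof. by case=> x1 x2; congr DualNum => /=; ring. Qed.
Fact dual_mulDl : left_distributive dual_mul (@GRing.add (dualnum R)).
Proof. by move=> x y z; congr DualNum => /=; ring. Qed.
Fact dual_one_neq0 : dual_one != 0.
Proof. by apply/eqP => -[] /eqP; rewrite oner_eq0. Qed.

HB.instance Definition _ := GRing.Zmodule_isComNzRing.Build (dualnum R)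
  dual_mulA dual_mulC dual_mul1 dual_mulDl dual_one_neq0.

Definition dual_real (r : R) : dualnum R := DualNum r 0.
Definition dual_eps : dualnum R := DualNum 0 1.

Lemma dualnumE x : x = dual_real (dre x) + dual_eps * dual_real (ddu x).
Proof. by case: x => x1 x2; congr DualNum => /=; ring. Qed.

Lemma dual_eps2 : dual_eps ^+ 2 = 0.
Proof. by rewrite expr2; congr DualNum => /=; ring. Qed.
End DualRing.

Section DualUnit.
Variable R : fieldType.
Implicit Types x y : dualnum R.

Definition dual_unit : {pred dualnum R} := fun x => dre x != 0.
Definition dual_inv x : dualnum R :=
  if dre x == 0 then x else DualNum (dre x)^-1 (- ddu x / dre x ^+ 2).

Fact dual_mulV : {in dual_unit, left_inverse 1 dual_inv *%R}.
Proof.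
move=> x; rewrite unfold_in => x0; rewrite /dual_inv (negbTE x0).
by congr DualNum => /=; field.
Qed.
Fact dual_unitP x y : y * x = 1 -> dual_unit x.
Proof.
move=> [yx1 _]; apply/eqP => x0; move: yx1 => /eqP.
by rewrite x0 mulr0 eq_sym oner_eq0.
Qed.
Fact dual_inv_out : {in [predC dual_unit], dual_inv =1 id}.
Proof. by move=> x; rewrite inE unfold_in negbK /dual_inv => ->. Qed.

HB.instance Definition _ := GRing.ComNzRing_hasMulInverse.Build (dualnum R)
  dual_mulV dual_unitP dual_inv_out.

Lemma dual_unitE x : (x \is a GRing.unit) = (dre x != 0).
Proof. by []. Qed.
End DualUnit.

Section DualAnalysis.
Variable R : realType.
Implicit Types a b c x y : dualnum R.

Definition dual_abs x : R := `|dre x|.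

(* Only meaningful for [0 < dre y]. *)
Definition dual_pow y c : dualnum R :=
  dual_real (dre y `^ dre c) *
  (1 + dual_eps R *
       dual_real (ddu y * dre c / dre y + ddu c * ln (dre y))).

Definition dual_cvgn (u : nat -> dualnum R) : Prop :=
  cvgn (fun n => dre (u n)) /\ cvgn (fun n => ddu (u n)).

(* Only meaningful under [dual_cvgn u]. *)
Definition dual_limn (u : nat -> dualnum R) : dualnum R :=
  DualNum (limn (fun n => dre (u n))) (limn (fun n => ddu (u n))).

Definition dual_shifted_fact a (k : nat) : dualnum R :=
  \prod_(0 <= i < k) (a + i%:R).

Definition gauss_term a1 a2 b1 x (k : nat) : dualnum R :=
  (dual_shifted_fact a1 k * dual_shifted_fact a2 k * x ^+ k) /
  (dual_shifted_fact b1 k * k`!%:R).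

Definition gauss_cvg a1 a2 b1 x : Prop :=
  dual_cvgn (series (gauss_term a1 a2 b1 x)).

(* The sum of the series, only meaningful under [gauss_cvg a1 a2 b1 x]. *)
Definition gauss2F1 a1 a2 b1 x : dualnum R :=
  dual_limn (series (gauss_term a1 a2 b1 x)).
End DualAnalysis.

(* Main.v *)
Require Import Defs.
From mathcomp Require Import all_boot all_order all_algebra.
From mathcomp Require Import ring lra.
From mathcomp Require Import all_classical all_reals all_analysis.

(** Everything follows from Pfaff's transformation, the first identity: applied
    twice, with the numerator parameters exchanged in between, it gives the second
    one ([euler]), because x |-> -x/(1 - x) is an involution.

    Pfaff's transformation is an instance of Euler's transformation of series
    ([euler_transform]). In the right-hand side, the factor (1 - x)^(-a-k) that
    accompanies (-x)^k is expanded by the binomial theorem; in the resulting double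
    series the coefficient of x^n is (a)_n/n! times a finite difference of
    (b - c)_k/(b)_k, which Chu-Vandermonde ([chu_vandermonde]) evaluates to
    (c)_n/(b)_n. The interchange of summations is legitimate when the real part of
    x has modulus less than 1/2. The hypotheses put this real part between -1 and
    1/2; if it is at most -1/2, then -x/(1 - x) has real part between 0 and 1/2, and
    the identity at that point, read backwards, is the identity at x ([pfaff]).

    All of this is carried out for dual numbers as such, not by differentiating
    the real identity with respect to the parameters. Two facts make it possible.
    First, the norms |x1| + K |x2| with K > 0 are submultiplicative and come
    arbitrarily close to |x1|, so the ratio test and geometric majorants work as
    for real series and see real parts only ([geom_bounded_ratio]). Second, the
    binomial series with dual exponent and dual argument sums to the dual power
    ([binomial_theorem]): along the ray t x the product of the series with
    (1 - t x)^a has derivative zero, in both parts. *)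

Set Implicit Arguments.
Unset Strict Implicit.
Unset Printing Implicit Defensive.
Import Order.TTheory GRing.Theory Num.Theory.
Import numFieldNormedType.Exports.
Local Open Scope classical_set_scope.
Local Open Scope ring_scope.

(** * Dual numbers, powers and shifted factorials *)

Section DualAlgebra.
Variable R : realType.
Implicit Types a b c x y : dualnum R.

Lemma dual_eqP x y : dre x = dre y -> ddu x = ddu y -> x = y.
Proof. by case: x y => ? ? [? ?] /= -> ->. Qed.

Lemma dreD x y : dre (x + y) = dre x + dre y. Proof. by []. Qed.
Lemma dduD x y : ddu (x + y) = ddu x + ddu y. Proof. by []. Qed.
Lemma dreB x y : dre (x - y) = dre x - dre y. Proof. by []. Qed.
Lemma dreN x : dre (- x) = - dre x. Proof. by []. Qed.
Lemma dduN x : ddu (- x) = - ddu x. Proof. by []. Qed.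
Lemma dreM x y : dre (x * y) = dre x * dre y. Proof. by []. Qed.
Lemma dduM x y : ddu (x * y) = dre x * ddu y + ddu x * dre y. Proof. by []. Qed.

Lemma dre_nat n : dre (n%:R : dualnum R) = n%:R.
Proof. by elim: n => // n IH; rewrite -addn1 !natrD dreD IH. Qed.

Lemma ddu_nat n : ddu (n%:R : dualnum R) = 0.
Proof. by elim: n => // n IH; rewrite -addn1 natrD dduD IH addr0. Qed.

Lemma dreV x : dre x^-1 = (dre x)^-1.
Proof.
rewrite {1}/GRing.inv /= /dual_inv; case: eqP => [e|_] //=.
by rewrite e invr0.
Qed.

Lemma dduV x : dre x != 0 -> ddu x^-1 = - ddu x / dre x ^+ 2.
Proof. by move=> /negbTE x0; rewrite {1}/GRing.inv /= /dual_inv x0. Qed.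

Lemma dre_sum (I : Type) (s : seq I) (P : pred I) (F : I -> dualnum R) :
  dre (\sum_(i <- s | P i) F i) = \sum_(i <- s | P i) dre (F i).
Proof. exact: (big_morph (@dre R) dreD). Qed.

Lemma ddu_sum (I : Type) (s : seq I) (P : pred I) (F : I -> dualnum R) :
  ddu (\sum_(i <- s | P i) F i) = \sum_(i <- s | P i) ddu (F i).
Proof. exact: (big_morph (@ddu R) dduD). Qed.

Lemma nat_unit n : (n.+1%:R : dualnum R) \is a GRing.unit.
Proof. by rewrite dual_unitE dre_nat pnatr_eq0. Qed.

Lemma fact_unit n : (n`!%:R : dualnum R) \is a GRing.unit.
Proof. by rewrite dual_unitE dre_nat pnatr_eq0 -lt0n fact_gt0. Qed.

Lemma shifted_fact0 a : dual_shifted_fact a 0 = 1.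
Proof. by rewrite /dual_shifted_fact big_nil. Qed.

Lemma shifted_factSr a n :
  dual_shifted_fact a n.+1 = dual_shifted_fact a n * (a + n%:R).
Proof. by rewrite /dual_shifted_fact big_nat_recr. Qed.

Lemma shifted_factD a m n :
  dual_shifted_fact a (m + n) =
  dual_shifted_fact a m * dual_shifted_fact (a + m%:R) n.
Proof.
elim: n => [|n IH]; first by rewrite addn0 shifted_fact0 mulr1.
by rewrite addnS !shifted_factSr IH natrD -mulrA addrA.
Qed.

Lemma shifted_factS a n :
  dual_shifted_fact a n.+1 = a * dual_shifted_fact (a + 1) n.
Proof.
by rewrite -add1n shifted_factD shifted_factSr shifted_fact0 mul1r addr0.
Qed.

Lemma shifted_fact_unit b n : (forall i, dre b <> - i%:R) ->
  dual_shifted_fact b n \is a GRing.unit.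
Proof.
move=> hb; elim: n => [|n IH]; first by rewrite shifted_fact0 unitr1.
rewrite shifted_factSr unitrM IH dual_unitE dreD dre_nat addr_eq0.
by apply/eqP/hb.
Qed.

Lemma dual_powD y b c : 0 < dre y ->
  dual_pow y (b + c) = dual_pow y b * dual_pow y c.
Proof.
move=> y0; have yn0 : dre y != 0 by rewrite gt_eqF.
apply: dual_eqP; rewrite /= powRD ?yn0 ?implybT//; first by ring.
by field.
Qed.

Lemma dual_pow0 y : dual_pow y 0 = 1.
Proof. by apply: dual_eqP; rewrite /= powRr0; ring. Qed.

Lemma dual_pow_nat y n : 0 < dre y -> dual_pow y n%:R = y ^+ n.
Proof.
move=> y0; have yn0 : dre y != 0 by rewrite gt_eqF.
elim: n => [|n IH]; first by rewrite dual_pow0.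
rewrite -addn1 natrD dual_powD// IH addn1 exprSr; congr (_ * _).
by apply: dual_eqP; rewrite /= powRr1 ?(ltW y0)//; [ring|field].
Qed.

Lemma dual_powMN y c : 0 < dre y -> dual_pow y c * dual_pow y (- c) = 1.
Proof. by move=> y0; rewrite -dual_powD// subrr dual_pow0. Qed.

(** With [dual_powD], this is what makes the prefactors of two successive Pfaff
    transformations combine, their bases being inverse to each other. *)
Lemma dual_powV y c : 0 < dre y -> dual_pow y^-1 c = dual_pow y (- c).
Proof.
move=> y0; have yn0 : dre y != 0 by rewrite gt_eqF.
have e : (dre y)^-1 `^ dre c = dre y `^ (- dre c).
  by rewrite -powR_inv1 ?(ltW y0)// -powRrM mulN1r.
apply: dual_eqP; rewrite /= dreV e; first by ring.
by rewrite dduV// lnV ?posrE//; field.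
Qed.

Lemma dual_powN y c : 0 < dre y -> dual_pow y (- c) = (dual_pow y c)^-1.
Proof.
move=> y0; have e := dual_powMN c y0.
have u : dual_pow y c \is a GRing.unit.
  by apply/unitrPr; exists (dual_pow y (- c)).
by apply: (mulrI u); rewrite e mulrV.
Qed.

(** Chu-Vandermonde: the terminating series 2F1(-n, c; b; 1), written with
    binomial coefficients so that it is an n-th finite difference. Pascal's rule
    turns the sum S(n, b, c) into S(n - 1, b, c) - (c/b) S(n - 1, b + 1, c + 1),
    which drives the induction on n with b and c varying. *)
Lemma chu_vandermonde b c n : (forall i, dre b <> - i%:R) ->
  \sum_(0 <= k < n.+1) 'C(n, k)%:R *
    ((-1) ^+ k * (dual_shifted_fact c k / dual_shifted_fact b k)) =
  dual_shifted_fact (b - c) n / dual_shifted_fact b n.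
Proof.
elim: n b c => [|n IH] b c hb.
  by rewrite big_nat1 !shifted_fact0 bin0 expr0 !mul1r.
have hb1 m : dre (b + 1) <> - m%:R.
  move=> e; apply: (hb m.+1); move: e; rewrite dreD /= -addn1 natrD => e.
  by rewrite opprD -e addrK.
pose g b c k := (-1) ^+ k * (dual_shifted_fact c k / dual_shifted_fact b k).
have bu : b \is a GRing.unit.
  by rewrite dual_unitE; apply/eqP => e; apply: (hb 0); rewrite e oppr0.
have gS k : g b c k.+1 = - (c / b) * g (b + 1) (c + 1) k.
  rewrite /g !shifted_factS invrM ?shifted_fact_unit// exprS; ring.
have -> : \sum_(0 <= k < n.+2) 'C(n.+1, k)%:R * g b c k =
   \sum_(0 <= k < n.+1) 'C(n, k)%:R * g b c k
   - (c / b) * \sum_(0 <= k < n.+1) 'C(n, k)%:R * g (b + 1) (c + 1) k.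
  rewrite big_nat_recl// [in RHS]big_nat_recl// !bin0 -addrA; congr (_ + _).
  have -> : \sum_(0 <= i < n) 'C(n, i.+1)%:R * g b c i.+1 =
            \sum_(0 <= i < n.+1) 'C(n, i.+1)%:R * g b c i.+1.
    by rewrite big_nat_recr//= bin_small// mul0r addr0.
  rewrite mulr_sumr -sumrB; apply: eq_bigr => k _.
  by rewrite binS natrD mulrDl; congr (_ + _); rewrite gS; ring.
rewrite !IH//.
have -> : b + 1 - (c + 1) = b - c by ring.
have ub := shifted_fact_unit n hb.
have ub1 := shifted_fact_unit n hb1.
have un : b + n%:R \is a GRing.unit.
  by rewrite dual_unitE dreD dre_nat addr_eq0; apply/eqP/hb.
rewrite [in RHS]shifted_factSr.
have e : (b * dual_shifted_fact (b + 1) n)^-1 =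
         (dual_shifted_fact b n * (b + n%:R))^-1.
  by rewrite -shifted_factS shifted_factSr.
rewrite shifted_factSr -[X in X - _](mulrK un).
have -> : c / b * (dual_shifted_fact (b - c) n / dual_shifted_fact (b + 1) n) =
   c * dual_shifted_fact (b - c) n * (b * dual_shifted_fact (b + 1) n)^-1.
  by rewrite (invrM bu ub1); ring.
by rewrite e (invrM ub un); ring.
Qed.

End DualAlgebra.

(** * Componentwise convergence and geometric growth *)

Section DualConvergence.
Variable R : realType.
Implicit Types (a b c l m x y : dualnum R) (u v : nat -> dualnum R).

Definition dual_cvg u l :=
  (dre (u n) @[n --> \oo] --> dre l) /\ (ddu (u n) @[n --> \oo] --> ddu l).

Lemma dual_cvg_lim u l : dual_cvg u l -> dual_limn u = l.
Proof. by case=> ul1 ul2; apply: dual_eqP; exact: cvg_lim. Qed.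

Lemma dual_cvgnP u : dual_cvgn u -> dual_cvg u (dual_limn u).
Proof. by []. Qed.

Lemma dual_cvg_unique u l m : dual_cvg u l -> dual_cvg u m -> l = m.
Proof. by move=> /dual_cvg_lim <- /dual_cvg_lim <-. Qed.

Lemma dual_cvg_cst l : dual_cvg (fun=> l) l.
Proof. by split; exact: cvg_cst. Qed.

Lemma dual_cvgD u v l m : dual_cvg u l -> dual_cvg v m ->
  dual_cvg (fun n => u n + v n) (l + m).
Proof. by move=> [? ?] [? ?]; split; exact: cvgD. Qed.

Lemma dual_cvgM u v l m : dual_cvg u l -> dual_cvg v m ->
  dual_cvg (fun n => u n * v n) (l * m).
Proof.
move=> [ul1 ul2] [vm1 vm2]; split; first exact: cvgM ul1 vm1.
by apply: cvgD; [exact: cvgM ul1 vm2|exact: cvgM ul2 vm1].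
Qed.

Lemma seriesMl c u n : series (fun k => c * u k) n = c * series u n.
Proof. by rewrite /series /= mulr_sumr. Qed.

Lemma dual_cvg_shiftn u l k :
  dual_cvg u l <-> dual_cvg (fun n => u (n + k)%N) l.
Proof.
by split=> -[]; move=> h1 h2; split; move: h1 h2;
  by rewrite -?(cvg_shiftn k (fun n => dre (u n)))
             -?(cvg_shiftn k (fun n => ddu (u n))).
Qed.

(** For every K >= 0 this is submultiplicative; as K goes to 0 it decreases to
    the modulus of the real part. Choosing K small is therefore the way to see
    that only real parts decide on convergence. *)
Definition dual_norm (K : R) x : R := `|dre x| + K * `|ddu x|.

Lemma dual_norm_ge0 K x : 0 <= K -> 0 <= dual_norm K x.
Proof. by move=> K0; rewrite addr_ge0 ?mulr_ge0. Qed.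

Lemma dual_normM K x y : 0 <= K ->
  dual_norm K (x * y) <= dual_norm K x * dual_norm K y.
Proof.
move=> K0; rewrite /dual_norm /= normrM.
have := ler_normD (dre x * ddu y) (ddu x * dre y); rewrite !normrM => h.
have := ler_wpM2l K0 h.
have := mulr_ge0 (mulr_ge0 K0 (normr_ge0 (ddu x)))
                 (mulr_ge0 K0 (normr_ge0 (ddu y))).
set p := `|dre x|; set q := `|ddu x|; set r := `|dre y|; set s := `|ddu y|.
by move=> h1 h2; lra.
Qed.

Lemma dre_le_norm x : `|dre x| <= dual_norm 1 x.
Proof. by rewrite /dual_norm mul1r lerDl. Qed.

Lemma ddu_le_norm x : `|ddu x| <= dual_norm 1 x.
Proof. by rewrite /dual_norm mul1r lerDr. Qed.

Lemma dual_norm_le K x : 0 < K -> dual_norm 1 x <= (1 + K^-1) * dual_norm K x.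
Proof.
move=> K0; rewrite /dual_norm mul1r mulrDl mul1r mulrDr mulKf ?gt_eqF//.
have := normr_ge0 (dre x); have := normr_ge0 (ddu x).
have : 0 <= K^-1 * `|dre x| by rewrite mulr_ge0// invr_ge0 ltW.
have : 0 <= K * `|ddu x| by rewrite mulr_ge0// ltW.
by lra.
Qed.

Lemma dual_norm_small x (r : R) : `|dre x| < r ->
  exists2 K, 0 < K & dual_norm K x < r.
Proof.
move=> xr; have D0 : 0 < `|ddu x| + 1 by rewrite ltr_wpDl.
exists ((r - `|dre x|) / (`|ddu x| + 1)); first by rewrite divr_gt0// subr_gt0.
rewrite /dual_norm -ltrBrDl mulrAC ltr_pdivrMr// ltr_pM2l ?subr_gt0//.
by rewrite ltrDl.
Qed.

Lemma dual_norm_cvg K u l : dual_cvg u l ->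
  dual_norm K (u n) @[n --> \oo] --> dual_norm K l.
Proof.
move=> [ul1 ul2]; apply: cvgD; first exact: cvg_norm.
by apply: cvgMr; exact: cvg_norm.
Qed.

(** The norm is the one of weight 1, but all weights K > 0 give the same notion
    because they give equivalent norms. *)
Definition geom_bounded u (r : R) :=
  exists C, forall n, dual_norm 1 (u n) <= C * r ^+ n.

(** The ratio test. The limit ratio l may have a large dual part, so the norm of
    weight 1 would not do: with a weight K for which l has norm less than r, the
    norm of u is multiplied by at most r from some rank N on, and the finitely
    many terms before N are absorbed in the constant. *)
Lemma geom_bounded_ratio u v l (r : R) :
  (forall n, u n.+1 = v n * u n) -> dual_cvg v l -> `|dre l| < r ->
  geom_bounded u r.
Proof.
move=> uS vl lr.
have r0 : 0 < r := le_lt_trans (normr_ge0 _) lr.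
have [K K0 lK] := dual_norm_small lr.
have K0' := ltW K0.
have [N _ HN] := cvgr_lt _ (dual_norm_cvg (K := K) vl) _ lK.
pose w n := dual_norm K (u n) / r ^+ n.
have w0 n : 0 <= w n by rewrite divr_ge0 ?dual_norm_ge0// exprn_ge0// ltW.
(* A sum rather than a maximum: it dominates each of the first ratios. *)
pose C := \sum_(n < N.+1) w n.
have small n : (n <= N)%N -> dual_norm K (u n) <= C * r ^+ n.
  move=> nN; rewrite -ler_pdivrMr ?exprn_gt0//.
  rewrite /C (bigD1 (Ordinal (nN : (n < N.+1)%N)))//= lerDl.
  by apply: sumr_ge0 => i _; exact: w0.
exists ((1 + K^-1) * C) => n.
apply: le_trans (dual_norm_le _ K0) _.
rewrite -mulrA ler_wpM2l ?addr_ge0 ?invr_ge0//.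
elim: n => [|n IH]; first exact: small.
have [nN|Nn] := ltnP n N; first exact: small.
rewrite uS; apply: le_trans (dual_normM _ _ K0') _.
rewrite exprS mulrCA; apply: ler_pM; rewrite ?dual_norm_ge0//.
exact/ltW/HN.
Qed.

Lemma geom_bounded_cvg0 u (r : R) : 0 <= r -> r < 1 -> geom_bounded u r ->
  dual_cvg u 0.
Proof.
move=> r0 r1 [C hC].
have h : C * r ^+ n @[n --> \oo] --> 0.
  by apply: cvg_geometric; rewrite ger0_norm.
have hN : - (C * r ^+ n) @[n --> \oo] --> 0 by rewrite -oppr0; exact: cvgN.
by split; apply: squeeze_cvgr hN h; apply: nearW => n; rewrite -ler_norml;
  apply: le_trans (hC n); [exact: dre_le_norm|exact: ddu_le_norm].
Qed.

Lemma geom_bounded_summable u (r : R) : 0 <= r -> r < 1 -> geom_bounded u r ->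
  dual_cvgn (series u).
Proof.
move=> r0 r1 [C hC].
have g : cvgn (series (geometric C r)).
  by apply: is_cvg_geometric_series; rewrite ger0_norm.
have C0 n : 0 <= C * r ^+ n.
  by apply: le_trans (hC n); exact: dual_norm_ge0.
have -> : series u = fun n =>
    DualNum (series (fun k => dre (u k)) n) (series (fun k => ddu (u k)) n).
  apply/funext => n; rewrite /series /=; apply: dual_eqP => /=.
    by rewrite dre_sum.
  by rewrite ddu_sum.
by split => /=; apply: normed_cvg; apply: series_le_cvg g => n //=;
  apply: le_trans (hC n); [exact: dre_le_norm|exact: ddu_le_norm].
Qed.

(** The quotient is 1 + (a - b)/(b + n), and both parts of 1/(b + n) vanish in
    the limit. *)
Lemma shifted_ratio_cvg a b : (forall i, dre b <> - i%:R) ->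
  dual_cvg (fun n => (a + n%:R) / (b + n%:R)) 1.
Proof.
move=> hb.
have bn0 n : dre (b + n%:R) != 0.
  by rewrite dreD dre_nat addr_eq0; apply/eqP/hb.
have h : (dre b + n%:R : R)^-1 @[n --> \oo] --> 0.
  have bp : (dre b + n%:R : R) @[n --> \oo] --> +oo.
    apply/cvgryPge => A; have := cvgr_idn (R := R).
    by move/cvgryPge/(_ (A - dre b)); apply: filterS => n; rewrite lerBlDl.
  apply/gtr0_cvgV0 => //.
  by move/cvgryPgt : bp; apply.
have inv0 : dual_cvg (fun n => (b + n%:R)^-1) 0.
  split.
    by under eq_fun do rewrite dreV dreD dre_nat.
  under eq_fun do rewrite dduV// dreD dduD ddu_nat dre_nat addr0 -exprVn.
  have -> : ddu (0 : dualnum R) = - ddu b * (0 * 0) by rewrite !mulr0.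
  by apply: cvgMr; under eq_fun do rewrite expr2; exact: cvgM.
have -> : (fun n => (a + n%:R) / (b + n%:R)) =
          (fun n => 1 + (a - b) * (b + n%:R)^-1).
  apply/funext => n; have u : b + n%:R \is a GRing.unit by rewrite dual_unitE.
  have e := divrr u; move: n%:R u e => k u e.
  by rewrite -[1 in RHS]e -mulrDl; congr (_ / _); ring.
rewrite -[X in dual_cvg _ X]addr0 -[X in dual_cvg _ (_ + X)](mulr0 (a - b)).
apply: dual_cvgD; first exact: dual_cvg_cst.
by apply: dual_cvgM => //; exact: dual_cvg_cst.
Qed.

Lemma shifted_ratio_bounded a b (r : R) : (forall i, dre b <> - i%:R) -> 1 < r ->
  geom_bounded (fun n => dual_shifted_fact a n / dual_shifted_fact b n) r.
Proof.
move=> hb r1; apply: geom_bounded_ratio (shifted_ratio_cvg a hb) _.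
  move=> n; rewrite !shifted_factSr invrM ?shifted_fact_unit//; first by ring.
  by rewrite dual_unitE dreD dre_nat addr_eq0; apply/eqP/hb.
by rewrite /= normr1.
Qed.

End DualConvergence.

(** * Derivatives of dual-valued functions of a real variable *)

Section DualDerivative.
Variable R : realType.
Implicit Types (a c d x : dualnum R) (F G : R -> dualnum R) (t : R).

Definition is_dual_derive F t d :=
  is_derive t (1 : R) (fun s : R => dre (F s)) (dre d) /\
  is_derive t (1 : R) (fun s : R => ddu (F s)) (ddu d).

Lemma dual_deriveM F G t d e : is_dual_derive F t d -> is_dual_derive G t e ->
  is_dual_derive (fun s => F s * G s) t (d * G t + F t * e).
Proof.
move=> [F1 F2] [G1 G2]; split.
  apply: (is_derive_eq (is_deriveM F1 G1)).
  by rewrite /= /GRing.scale /=; ring.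
apply: (is_derive_eq (is_deriveD (is_deriveM F1 G2) (is_deriveM F2 G1))).
by rewrite /= /GRing.scale /=; ring.
Qed.

(** The mean value theorem applied to each part. *)
Lemma dual_derive_cst F :
  (forall t : R, 0 <= t <= 1 -> is_dual_derive F t 0) -> F 1 = F 0.
Proof.
move=> F'0.
have cst (f : R -> R) :
    (forall s : R, 0 <= s <= 1 -> is_derive s (1 : R) f 0) -> f 1 = f 0.
  move=> f'0; have [] := @MVT_segment R f (fun=> 0) 0 1 ler01.
  - move=> s; rewrite in_itv /= => /andP[s0 s1].
    by apply: f'0; rewrite !ltW.
  - apply: derivable_within_continuous => s; rewrite in_itv /= => s01.
    by have [] := f'0 s s01.
  - by move=> s _ /eqP; rewrite mul0r subr_eq0 => /eqP.
apply: dual_eqP.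
  by apply: (cst (fun s => dre (F s))) => s /F'0[].
by apply: (cst (fun s => ddu (F s))) => s /F'0[].
Qed.

(** The usual rule c y' y^(c-1); the real part is the power rule, and the dual
    part checks that the logarithm in [dual_pow] is the right one. *)
Lemma dual_derive_pow F t c d : 0 < dre (F t) -> is_dual_derive F t d ->
  is_dual_derive (fun s => dual_pow (F s) c) t
    (c * d * (F t)^-1 * dual_pow (F t) c).
Proof.
move=> y0 [F1 F2]; have yn0 : dre (F t) != 0 by rewrite gt_eqF.
have P := is_derive1_comp (is_derive1_powR (dre c) y0) F1.
have L := is_derive1_comp (is_derive1_ln y0) F1.
have V := is_deriveV yn0 F1.
have pB : dre (F t) `^ (dre c - 1) = dre (F t) `^ dre c / dre (F t).
  by rewrite powRD ?yn0 ?implybT// powR_inv1 ?ltW.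
split.
  have -> : (fun s => dre (dual_pow (F s) c)) =
            (fun s => dre (F s) `^ dre c).
    by apply/funext => s /=; ring.
  apply: (is_derive_eq P).
  by rewrite /= dreV pB; field.
have -> : (fun s => ddu (dual_pow (F s) c)) = fun s =>
    dre (F s) `^ dre c * (ddu (F s) * (dre c * (dre (F s))^-1)
                          + ddu c * ln (dre (F s))).
  by apply/funext => s /=; ring.
have K (k : R) := is_derive_cst k t (1 : R).
apply: (is_derive_eq (is_deriveM P (is_deriveD
   (is_deriveM F2 (is_deriveM (K (dre c)) V)) (is_deriveM (K (ddu c)) L)))).
rewrite /= !fctE /= /GRing.scale /= pB dreV dduV//.
by field.
Qed.

End DualDerivative.

(** * The binomial series *)

Section DualBinomial.
Variable R : realType.
Implicit Types (a x : dualnum R) (t r : R).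

(** The coefficient of x^n in (1 - x)^(-a), not the one of (1 + x)^a. *)
Definition binomial_coef a n : dualnum R := dual_shifted_fact a n / n`!%:R.

Definition binomial_term a x n : dualnum R := binomial_coef a n * x ^+ n.

Definition binomial_sum a x : dualnum R := dual_limn (series (binomial_term a x)).

Lemma one_neq_opp_nat i : dre (1 : dualnum R) <> - i%:R.
Proof.
by rewrite /= => e; have := ler0n R i; lra.
Qed.

Lemma binomial_coef0 a : binomial_coef a 0 = 1.
Proof. by rewrite /binomial_coef shifted_fact0 divr1. Qed.

Lemma binomial_coefSr a n :
  binomial_coef a n.+1 = (a + n%:R) / n.+1%:R * binomial_coef a n.
Proof.
rewrite /binomial_coef shifted_factSr factS natrM.
by rewrite (invrM (nat_unit _ _) (fact_unit _ _)); ring.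
Qed.

(** Differentiating the series termwise multiplies it by a and raises the
    parameter to a + 1. *)
Lemma binomial_coefS a n :
  n.+1%:R * binomial_coef a n.+1 = a * binomial_coef (a + 1) n.
Proof.
rewrite /binomial_coef shifted_factS factS natrM.
rewrite (invrM (nat_unit _ _) (fact_unit _ _)).
have e := mulrV (nat_unit R n).
rewrite [LHS](_ : _ = n.+1%:R / n.+1%:R * (a * dual_shifted_fact (a + 1) n / n`!%:R));
  last by ring.
by rewrite e mul1r mulrA.
Qed.

Lemma binomial_coef_pascal a n :
  binomial_coef (a + 1) n.+1 = binomial_coef (a + 1) n + binomial_coef a n.+1.
Proof.
apply: (mulrI (nat_unit R n)); rewrite mulrDr (binomial_coefS a) (binomial_coefSr (a + 1)).
rewrite mulrA [n.+1%:R * (_ / _)]mulrC divrK ?nat_unit// -mulrDl.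
by congr (_ * _); rewrite -natr1; ring.
Qed.

Lemma binomial_term_bounded a x r : `|dre x| < r -> geom_bounded (binomial_term a x) r.
Proof.
move=> xr; have c := dual_cvgM (shifted_ratio_cvg a one_neq_opp_nat) (dual_cvg_cst x).
apply: geom_bounded_ratio c _ => [n|]; last by rewrite mul1r.
by rewrite /binomial_term binomial_coefSr exprS -nat1r; ring.
Qed.

Lemma binomial_cvg a x : `|dre x| < 1 -> dual_cvgn (series (binomial_term a x)).
Proof.
move=> x1; pose r := (`|dre x| + 1) / 2.
have [xr r1] : `|dre x| < r /\ r < 1 by split; rewrite /r; lra.
apply: geom_bounded_summable r1 (binomial_term_bounded a xr).
exact: le_trans (ltW xr).
Qed.

Lemma binomial_term_cvg0 a x : `|dre x| < 1 -> dual_cvg (binomial_term a x) 0.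
Proof.
move=> x1; pose r := (`|dre x| + 1) / 2.
have [xr r1] : `|dre x| < r /\ r < 1 by split; rewrite /r; lra.
apply: geom_bounded_cvg0 r1 (binomial_term_bounded a xr).
exact: le_trans (ltW xr).
Qed.

(** Dividing by 1 - x forms the partial sums of the coefficients, which Pascal's
    rule [binomial_coef_pascal] identifies as the coefficients for a + 1. *)
Lemma binomial_sum_shift a x : `|dre x| < 1 ->
  (1 - x) * binomial_sum (a + 1) x = binomial_sum a x.
Proof.
move=> x1; have Sa := dual_cvgnP (binomial_cvg a x1).
have Sb := dual_cvgnP (binomial_cvg (a + 1) x1).
have part n : series (binomial_term a x) (n + 1)%N =
    (1 - x) * series (binomial_term (a + 1) x) (n + 1)%N
    + x * binomial_term (a + 1) x n.
  elim: n => [|n IH].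
    by rewrite /series /= !big_nat1 /binomial_term !binomial_coef0; ring.
  rewrite addSn /series /= big_nat_recr//= [in RHS]big_nat_recr//=.
  move: IH; rewrite /series /= => ->; rewrite addn1 /binomial_term.
  by rewrite binomial_coef_pascal !exprS; ring.
apply: dual_cvg_unique (Sa).
apply/(dual_cvg_shiftn _ _ 1).
rewrite (funext part) -[X in dual_cvg _ X]addr0 -[X in dual_cvg _ (_ + X)](mulr0 x).
apply: dual_cvgD; apply: dual_cvgM; try exact: dual_cvg_cst.
- exact: (iffLR (dual_cvg_shiftn _ _ 1) Sb).
- exact: binomial_term_cvg0.
Qed.

End DualBinomial.

Section BinomialTheorem.
Variable R : realType.
Implicit Types (a x z : dualnum R).

(** Along the ray through x, each part f of the sum is a real power series in
    the parameter. Its formal derivatives are again binomial series, with a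
    raised to a + 1 and a + 2, so the hypotheses of termwise differentiation are
    instances of one convergence statement. The constant factor z keeps track of
    what the differentiations bring out. *)
Lemma binomial_sum_derive_coord (f : dualnum R -> R) a x (t : R) :
  {morph f : u v / u + v} ->
  (forall r u, f (dual_real r * u) = r * f u) ->
  (forall u l, dual_cvg u l -> f (u n) @[n --> \oo] --> f l) ->
  (forall u, f (dual_limn u) = limn (fun n => f (u n))) ->
  `|dre x| < 1 -> `|t| <= 1 ->
  is_derive t (1 : R) (fun s : R => f (binomial_sum a (dual_real s * x)))
    (f (a * x * binomial_sum (a + 1) (dual_real t * x))).
Proof.
move=> fD fZ fcvg flim x1 t1.
pose c z b n := f (z * binomial_term b x n).
have f0 : f 0 = 0 by rewrite -[X in f X](mulr0 (dual_real 0)) fZ mul0r.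
have realX (s : R) n : dual_real s ^+ n = dual_real (s ^+ n).
  elim: n => [|n IH]; first by rewrite !expr0.
  by rewrite !exprS IH; apply: dual_eqP => /=; ring.
have pseriesE z b s : pseries (c z b) s =
    fun n => f (z * series (binomial_term b (dual_real s * x)) n).
  apply/funext => n; rewrite /pseries /series /= mulr_sumr (big_morph f fD f0).
  apply: eq_bigr => k _; rewrite /c /binomial_term exprMn realX mulrC -fZ.
  by congr (f _); ring.
have pcvg z b s : `|s * dre x| < 1 ->
    pseries (c z b) s @ \oo --> f (z * binomial_sum b (dual_real s * x)).
  move=> sx; rewrite pseriesE; apply: (fcvg _ _ _).
  apply: dual_cvgM; first exact: dual_cvg_cst.
  by apply/dual_cvgnP/binomial_cvg; rewrite dreM.
have diffs z b : pseries_diffs (c z b) = c (z * b * x) (b + 1).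
  apply/funext => n; rewrite /pseries_diffs /c -fZ; congr (f _).
  have -> : dual_real n.+1%:R = n.+1%:R :> dualnum R.
    by apply: dual_eqP; rewrite ?dre_nat ?ddu_nat.
  rewrite [LHS](_ : _ = z * (n.+1%:R * binomial_coef b n.+1) * x ^+ n.+1).
    by rewrite binomial_coefS /binomial_term exprS; ring.
  by rewrite /binomial_term; ring.
(* A point beyond 1 on the ray, still within the domain of convergence. *)
pose K : R := 2 / (1 + `|dre x|).
have D0 : 0 < 1 + `|dre x| by rewrite ltr_pwDl.
have K0 : 0 < K by rewrite divr_gt0.
have K1 : 1 < K by rewrite ltr_pdivlMr// mul1r; lra.
have Kx : `|K * dre x| < 1.
  by rewrite normrM (gtr0_norm K0) mulrAC ltr_pdivrMr// mul1r; lra.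
have tx : `|t * dre x| < 1.
  rewrite normrM; apply: le_lt_trans x1; rewrite -[leRHS]mul1r.
  by rewrite ler_wpM2r.
have := @pseries_snd_diffs R (c 1 a) K t.
rewrite !diffs mul1r => H.
have -> : (fun s : R => f (binomial_sum a (dual_real s * x))) =
          (fun s => limn (pseries (c 1 a) s)).
  apply/funext => s; rewrite pseriesE flim; congr (limn _).
  by apply/funext => n; rewrite mul1r.
have -> : f (a * x * binomial_sum (a + 1) (dual_real t * x)) =
          limn (pseries (c (a * x) (a + 1)) t).
  by apply/esym/cvg_lim => //; exact: pcvg.
apply: H; [exact: cvgP (pcvg _ _ _ Kx)..|].
by rewrite (gtr0_norm K0) (le_lt_trans t1).
Qed.

Lemma binomial_sum_derive a x (t : R) : `|dre x| < 1 -> `|t| <= 1 ->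
  is_dual_derive (fun s => binomial_sum a (dual_real s * x)) t
    (a * x * binomial_sum (a + 1) (dual_real t * x)).
Proof.
move=> x1 t1; split; apply: binomial_sum_derive_coord => //.
- by move=> u l [].
- by move=> r u; rewrite dduM /= mul0r addr0.
- by move=> u l [].
Qed.

Lemma binomial_sum0 a : binomial_sum a 0 = 1.
Proof.
apply: dual_cvg_lim; apply/(dual_cvg_shiftn _ _ 1).
have -> : (fun n => series (binomial_term a 0) (n + 1)%N) = fun=> 1.
  apply/funext => n; rewrite addn1 /series /= big_nat_recl// big1 => [|i _].
    by rewrite /binomial_term binomial_coef0 expr0; ring.
  by rewrite /binomial_term expr0n mulr0.
exact: dual_cvg_cst.
Qed.

Lemma dual_pow1 a : dual_pow 1 a = 1.
Proof. by apply: dual_eqP; rewrite /= powR1 ln1; ring. Qed.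

(** The product of the sum at t x with (1 - t x)^a has zero derivative for t in
    [0, 1], by [binomial_sum_derive] and [binomial_sum_shift], and equals 1 at
    t = 0. The ray t x, with x dual, treats the real and dual parts of the
    variable at once. *)
Theorem binomial_theorem a x : `|dre x| < 1 ->
  dual_cvg (series (binomial_term a x)) (dual_pow (1 - x) (- a)).
Proof.
move=> x1.
pose F t := binomial_sum a (dual_real t * x) * dual_pow (1 - dual_real t * x) a.
have dom (t : R) : 0 <= t <= 1 -> `|t| <= 1 /\ `|t * dre x| < 1.
  move=> /andP[t0 t1]; rewrite ger0_norm//; split=> //.
  rewrite normrM ger0_norm//; apply: le_lt_trans x1.
  by rewrite -[leRHS]mul1r ler_wpM2r.
have pos (y : dualnum R) : `|dre y| < 1 -> 0 < dre (1 - y).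
  by move=> y1; rewrite dreB subr_gt0; apply: le_lt_trans (ler_norm _) y1.
have F'0 (t : R) : 0 <= t <= 1 -> is_dual_derive F t 0.
  move=> /dom[t1 tx].
  have y0 := @pos (dual_real t * x) tx.
  have path : is_dual_derive (fun s => 1 - dual_real s * x) t (- x).
    have affine (k m : R) : is_derive t (1 : R) (fun s : R => k + m * s) m.
      apply: (is_derive_eq (is_deriveD (is_derive_cst k t (1 : R))
                                       (is_deriveZ m (is_derive_id t (1 : R))))).
      by rewrite add0r /GRing.scale /= mulr1.
    split.
      have -> : (fun s => dre (1 - dual_real s * x)) = fun s => 1 + - dre x * s.
        by apply/funext => s /=; ring.
      exact: affine.
    have -> : (fun s => ddu (1 - dual_real s * x)) = fun s => 0 + - ddu x * s.
      by apply/funext => s /=; ring.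
    exact: affine.
  have yu : 1 - dual_real t * x \is a GRing.unit by rewrite dual_unitE gt_eqF.
  have := dual_deriveM (binomial_sum_derive a x1 t1) (dual_derive_pow a y0 path).
  congr (is_dual_derive _ _ _).
  rewrite -(binomial_sum_shift a (x := dual_real t * x))//.
  move: yu; set y := 1 - _ => yu.
  set B := binomial_sum _ _; set P := dual_pow _ _.
  have e := mulrV yu.
  rewrite [LHS](_ : _ = a * x * B * P * (1 - y * y^-1)); last by ring.
  by rewrite e subrr mulr0.
have F1 : F 1 = binomial_sum a x * dual_pow (1 - x) a.
  by rewrite /F -[dual_real 1]/(1 : dualnum R) mul1r.
have F0 : F 0 = 1.
  rewrite /F -[dual_real 0]/(0 : dualnum R) mul0r subr0 binomial_sum0.
  by rewrite dual_pow1 mulr1.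
have e := dual_derive_cst F'0; rewrite F1 F0 in e.
have <- : binomial_sum a x = dual_pow (1 - x) (- a).
  move/(congr1 ( *%R^~ (dual_pow (1 - x) (- a)))): e.
  by rewrite /= -mulrA dual_powMN ?pos// mulr1 mul1r.
exact/dual_cvgnP/binomial_cvg.
Qed.

End BinomialTheorem.

(** * Interchange of summations *)

Section SeriesExchange.
Variable R : realType.

Lemma cvg_sum_nat (N : nat) (u : nat -> nat -> R) (l : nat -> R) :
  (forall k, u k n @[n --> \oo] --> l k) ->
  \sum_(0 <= k < N) u k n @[n --> \oo] --> \sum_(0 <= k < N) l k.
Proof.
move=> ul; elim: N => [|N IH].
  by rewrite big_nil; under eq_fun do rewrite big_nil; exact: cvg_cst.
rewrite big_nat_recr//=; under eq_fun do rewrite big_nat_recr//=.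
exact: cvgD.
Qed.

(** Fubini for a lower triangular array whose rows have absolute sums bounded by
    a summable u: the first N columns and the first N rows differ only by entries
    in the rows from N on, so their sums differ by at most the tail of u. *)
Lemma series_exchange (T : nat -> nat -> R) (u H : nat -> R) (L : R) :
  (forall n, \sum_(0 <= k < n.+1) `|T n k| <= u n) ->
  cvgn (series u) ->
  (forall n k, (n < k)%N -> T n k = 0) ->
  (forall k, series (T ^~ k) @ \oo --> H k) ->
  series (fun n => \sum_(0 <= k < n.+1) T n k) @ \oo --> L ->
  series H @ \oo --> L.
Proof.
move=> Tu su T0 TH TL.
pose U := limn (series u).
pose rows := series (fun n => \sum_(0 <= k < n.+1) T n k).
have rowsE N : rows N = \sum_(0 <= n < N) \sum_(0 <= k < N) T n k.
  rewrite /rows /series /=; apply: eq_big_nat => n /= nN.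
  rewrite (big_cat_nat (n := n.+1) _ nN)//= [X in _ + X]big1_seq ?addr0//.
  by move=> k /andP[_]; rewrite mem_index_iota => /andP[nk _]; exact: T0.
have row_le N n : (N <= n)%N -> `|\sum_(0 <= k < N) T n k| <= u n.
  move=> Nn; apply: le_trans (ler_norm_sum _ _ _) _; apply: le_trans (Tu n).
  rewrite (big_cat_nat (n := N) _ (leqW Nn))//= lerDl.
  by apply: sumr_ge0.
have tail N M : (N <= M)%N ->
    `|\sum_(0 <= k < N) series (T ^~ k) M - rows N| <= series u M - series u N.
  move=> NM; rewrite rowsE exchange_big/=.
  rewrite (sub_series_geq (fun n => \sum_(0 <= k < N) T n k) NM).
  rewrite (sub_series_geq u NM).
  apply: le_trans (ler_norm_sum _ _ _) _.
  rewrite big_nat_cond [leRHS]big_nat_cond; apply: ler_sum => n.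
  by rewrite andbT => /andP[Nn _]; exact: row_le.
have err N : `|series H N - rows N| <= U - series u N.
  have c1 : `|\sum_(0 <= k < N) series (T ^~ k) M - rows N| @[M --> \oo]
      --> `|series H N - rows N|.
    by apply: cvg_norm; apply: cvgB; [exact: cvg_sum_nat|exact: cvg_cst].
  have c2 : series u M - series u N @[M --> \oo] --> U - series u N.
    by apply: cvgB => //; exact: cvg_cst.
  apply: ler_cvg_to c1 c2 _.
  by exists N => // M /=; exact: tail.
have err0 : U - series u N @[N --> \oo] --> 0.
  by rewrite -[X in _ --> X](subrr U); apply: cvgB => //; exact: cvg_cst.
have err0N : - (U - series u N) @[N --> \oo] --> 0.
  by rewrite -[X in _ --> X]oppr0; exact: cvgN.
have diff0 : series H N - rows N @[N --> \oo] --> 0.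
  by apply: squeeze_cvgr err0N err0; apply: nearW => N; rewrite -ler_norml.
rewrite -[L]add0r.
have -> : series H = fun N => series H N - rows N + rows N.
  by apply/funext => N; rewrite subrK.
exact: cvgD.
Qed.

Implicit Types (a b c x y l : dualnum R) (d : nat -> dualnum R).

Lemma dual_cvg_seriesE (v : nat -> dualnum R) l : dual_cvg (series v) l <->
  (series (fun n => dre (v n)) @ \oo --> dre l) /\
  (series (fun n => ddu (v n)) @ \oo --> ddu l).
Proof.
rewrite /dual_cvg.
have -> : (fun n => dre (series v n)) = series (fun n => dre (v n)).
  by apply/funext => n; rewrite /series /= dre_sum.
have -> // : (fun n => ddu (series v n)) = series (fun n => ddu (v n)).
by apply/funext => n; rewrite /series /= ddu_sum.
Qed.

Lemma dual_series_exchange (T : nat -> nat -> dualnum R) (u : nat -> R)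
    (H : nat -> dualnum R) l :
  (forall n, \sum_(0 <= k < n.+1) dual_norm 1 (T n k) <= u n) ->
  cvgn (series u) ->
  (forall n k, (n < k)%N -> T n k = 0) ->
  (forall k, dual_cvg (series (T ^~ k)) (H k)) ->
  dual_cvg (series (fun n => \sum_(0 <= k < n.+1) T n k)) l ->
  dual_cvg (series H) l.
Proof.
move=> Tu su T0 TH /dual_cvg_seriesE[TL1 TL2]; apply/dual_cvg_seriesE; split.
  apply: (series_exchange (T := fun n k => dre (T n k)) _ su).
  - move=> n; apply: le_trans (Tu n).
    by apply: ler_sum => k _; exact: dre_le_norm.
  - by move=> n k nk; rewrite T0.
  - by move=> k; have /dual_cvg_seriesE[] := TH k.
  - by under [X in series X]eq_fun do rewrite -dre_sum.
apply: (series_exchange (T := fun n k => ddu (T n k)) _ su).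
- move=> n; apply: le_trans (Tu n).
  by apply: ler_sum => k _; exact: ddu_le_norm.
- by move=> n k nk; rewrite T0.
- by move=> k; have /dual_cvg_seriesE[] := TH k.
- by under [X in series X]eq_fun do rewrite -ddu_sum.
Qed.

End SeriesExchange.

(** * The Euler series transformation *)

Section EulerTransform.
Variable R : realType.
Implicit Types (a b c x y l : dualnum R) (d : nat -> dualnum R).

Lemma dual_norm_nat n y : dual_norm 1 (n%:R * y) = n%:R * dual_norm 1 y.
Proof.
by rewrite /dual_norm dreM dduM dre_nat ddu_nat mul0r addr0 !normrM normr_nat; ring.
Qed.

Lemma dual_norm_sign n y : dual_norm 1 ((-1) ^+ n * y) = dual_norm 1 y.
Proof.
rewrite -signr_odd mulr_sign; case: odd => //.
by rewrite /dual_norm dreN dduN !normrN.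
Qed.

Lemma binomial_coefD a k n :
  binomial_coef a (n + k) * 'C(n + k, k)%:R =
  binomial_coef a k * binomial_coef (a + k%:R) n.
Proof.
have ku := fact_unit R k; have nu := fact_unit R n.
apply: (mulrI nu); apply: (mulrI ku).
rewrite /binomial_coef addnC shifted_factD.
have e : k`!%:R * (n`!%:R * 'C(k + n, k)%:R) = (k + n)`!%:R :> dualnum R.
  by rewrite -!natrM -(bin_fact (leq_addr n k)) addKn mulnA mulnC.
have ek := mulVr ku; have en := mulVr nu; have ekn := mulVr (fact_unit R (k + n)).
rewrite -e in ekn *.
set A := dual_shifted_fact a k; set B := dual_shifted_fact _ n.
set k' := k`!%:R in ku ek ekn *; set n' := n`!%:R in nu en ekn *.
set C := 'C(_, _)%:R in ekn *.
transitivity (A * B * ((k' * (n' * C))^-1 * (k' * (n' * C)))); first by ring.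
transitivity (A * B * ((k'^-1 * k') * (n'^-1 * n'))); last by ring.
by rewrite ekn ek en mulr1.
Qed.

(** Expanding (1 - x)^(-a-k) by the binomial theorem turns the sum over k of
    (a)_k/k! d_k (-x)^k (1 - x)^(-a-k) into a double sum; collected by powers of
    x, the coefficient of x^n is (a)_n/n! times the n-th difference of d. The
    condition |x|(1 + r) < 1 makes the double sum absolutely convergent: the terms
    with x^n add up to at most (|x|(1 + r))^n, roughly, by Newton's formula. *)
Theorem euler_transform a x d (r : R) l :
  0 <= r -> `|dre x| * (1 + r) < 1 -> geom_bounded d r ->
  dual_cvg (series (fun n => binomial_term a x n *
    \sum_(0 <= k < n.+1) 'C(n, k)%:R * ((-1) ^+ k * d k))) l ->
  dual_cvg (series (fun k => dual_pow (1 - x) (- a) *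
    (binomial_coef a k * d k * (- x / (1 - x)) ^+ k))) l.
Proof.
move=> r0 xr [D hD] rows.
have s0 : 0 < 1 + r by rewrite ltr_pwDl.
have x1 : `|dre x| < 1.
  by apply: le_lt_trans xr; rewrite ler_peMr// lerDl.
have xV : `|dre x| < (1 + r)^-1 by rewrite -[ltRHS]mul1r ltr_pdivlMr.
(* [binomial_term_bounded] needs a rate strictly above |x|; take the midpoint
   of the room that the hypothesis leaves. *)
pose q := (`|dre x| + (1 + r)^-1) / 2.
have xq : `|dre x| < q by rewrite /q; lra.
have qr : q * (1 + r) < 1 by rewrite -ltr_pdivlMr// mul1r /q; lra.
have q0 : 0 <= q := le_trans (normr_ge0 _) (ltW xq).
have [C hC] := binomial_term_bounded a xq.
have y0 : 0 < dre (1 - x).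
  by rewrite dreB subr_gt0; apply: le_lt_trans (ler_norm _) x1.
pose T n k := binomial_term a x n * ('C(n, k)%:R * ((-1) ^+ k * d k)).
pose u n := C * D * (q * (1 + r)) ^+ n.
apply: (dual_series_exchange (T := T) (u := u)).
- move=> n; rewrite /u exprMn exprDn big_mkord mulrACA mulr_sumr mulr_sumr.
  apply: ler_sum => k _; rewrite /T.
  apply: le_trans (dual_normM _ _ ler01) _.
  apply: ler_pM; rewrite ?dual_norm_ge0// dual_norm_nat dual_norm_sign.
  by rewrite expr1n mul1r mulrnAr -[leRHS]mulr_natl ler_wpM2l.
- apply: is_cvg_geometric_series.
  by rewrite ger0_norm// mulr_ge0// ltW.
- by move=> n k nk; rewrite /T bin_small// mul0r mulr0.
- move=> k; apply/(dual_cvg_shiftn _ _ k).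
  have -> : (fun n => series (T ^~ k) (n + k)%N) = fun n =>
      binomial_coef a k * d k * (- x) ^+ k *
      series (binomial_term (a + k%:R) x) n.
    apply/funext => n; rewrite -seriesMl; elim: n => [|n IH].
      rewrite /series /= big_nil big_nat_cond big1// => i.
      by rewrite andbT => /andP[_ ik]; rewrite /T bin_small// mul0r mulr0.
    rewrite addSn !seriesSr IH; congr (_ + _).
    have e := binomial_coefD a k n.
    rewrite /T /binomial_term -[- x]mulN1r exprMn exprD.
    rewrite [LHS](_ : _ = binomial_coef a (n + k) * 'C(n + k, k)%:R *
      (x ^+ n * x ^+ k * ((-1) ^+ k * d k))); last by ring.
    by rewrite e; ring.
  rewrite [X in dual_cvg _ X](_ : _ = binomial_coef a k * d k * (- x) ^+ k *
      dual_pow (1 - x) (- (a + k%:R))).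
    by apply: dual_cvgM; [exact: dual_cvg_cst|exact: binomial_theorem].
  rewrite opprD dual_powD// [dual_pow _ (- k%:R)]dual_powN// dual_pow_nat//.
  by rewrite -exprVn exprMn; ring.
- congr (dual_cvg (series _) l): rows; apply/funext => n.
  by rewrite mulr_sumr.
Qed.

End EulerTransform.

(** * The transformations of Pfaff and Euler *)

Section DualGauss.
Variable R : realType.
Implicit Types (a b c x : dualnum R).

Lemma gauss_termE a c b x k : (forall i, dre b <> - i%:R) ->
  gauss_term a c b x k = binomial_term a x k *
    (dual_shifted_fact c k / dual_shifted_fact b k).
Proof.
move=> hb; rewrite /gauss_term /binomial_term /binomial_coef.
by rewrite (invrM (shifted_fact_unit k hb) (fact_unit R k)); ring.
Qed.

Lemma gauss_termC a c b x : gauss_term a c b x = gauss_term c a b x.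
Proof. by apply/funext => k; rewrite /gauss_term (mulrC (dual_shifted_fact a k)). Qed.

Lemma gauss2F1C a c b x : gauss2F1 a c b x = gauss2F1 c a b x.
Proof. by rewrite /gauss2F1 gauss_termC. Qed.

Lemma gauss_summable a c b x : (forall i, dre b <> - i%:R) -> `|dre x| < 1 ->
  gauss_cvg a c b x.
Proof.
move=> hb x1; pose r := (`|dre x| + 1) / 2.
have [xr r1] : `|dre x| < r /\ r < 1 by split; rewrite /r; lra.
have ratio := dual_cvgM (dual_cvgM (shifted_ratio_cvg a (@one_neq_opp_nat R))
  (shifted_ratio_cvg c hb)) (dual_cvg_cst x).
apply: (geom_bounded_summable _ r1 (geom_bounded_ratio _ ratio _)).
- exact: le_trans (ltW xr).
- move=> n; rewrite !gauss_termE// /binomial_term binomial_coefSr !shifted_factSr.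
  rewrite (invrM (shifted_fact_unit n hb)); last first.
    by rewrite dual_unitE dreD dre_nat addr_eq0; apply/eqP/hb.
  by rewrite exprS -nat1r; ring.
- by rewrite !mul1r.
Qed.

(** The Euler transformation of the sequence d_k = (b - c)_k/(b)_k, whose n-th
    difference is (c)_n/(b)_n by Chu-Vandermonde. As d has every growth rate
    above 1, the absolute convergence condition amounts to |x| < 1/2. *)
Lemma pfaff_half a c b x : (forall i, dre b <> - i%:R) -> `|dre x| < 2^-1 ->
  `|dre (- x / (1 - x))| < 1 ->
  gauss2F1 a c b x =
  dual_pow (1 - x) (- a) * gauss2F1 a (b - c) b (- x / (1 - x)).
Proof.
move=> hb x2 z1.
have x1 : `|dre x| < 1 by lra.
have [r r1 xr] : exists2 r, 1 < r & `|dre x| * (1 + r) < 1.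
  (* |x| (5/2 - |x|) is increasing on [0, 1/2], and equals 1 at 1/2. *)
  exists (1 + (2^-1 - `|dre x|)); first by lra.
  have := normr_ge0 (dre x); set t := `|dre x| in x2 *; move=> t0.
  by nra.
have hl := dual_cvgnP (gauss_summable a c hb x1).
have hr := dual_cvgnP (gauss_summable a (b - c) hb z1).
have d_bounded := shifted_ratio_bounded (b - c) hb r1.
have := euler_transform (a := a) (l := gauss2F1 a c b x) _ xr d_bounded.
have -> : (fun n => binomial_term a x n * \sum_(0 <= k < n.+1) 'C(n, k)%:R *
    ((-1) ^+ k * (dual_shifted_fact (b - c) k / dual_shifted_fact b k))) =
    gauss_term a c b x.
  apply/funext => n; rewrite chu_vandermonde// gauss_termE//.
  by rewrite opprB addrC subrK.
move=> /(_ _ hl) H; apply: dual_cvg_unique (H _) _; first by rewrite ltW// (lt_trans ltr01).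
have := dual_cvgM (dual_cvg_cst (dual_pow (1 - x) (- a))) hr.
congr dual_cvg; apply/funext => n; rewrite -seriesMl.
congr (series _ n); apply/funext => k; rewrite gauss_termE// /binomial_term.
by congr (_ * _); ring.
Qed.

Lemma pfaff_argument_one_sub x : dre (1 - x) != 0 ->
  1 - (- x / (1 - x)) = (1 - x)^-1.
Proof.
move=> y0; have e : (1 - x) / (1 - x) = 1 by rewrite divrr// dual_unitE.
by rewrite -[X in X - _]e -mulrBl opprK subrK mul1r.
Qed.

Lemma pfaff_argument_involutive x : dre (1 - x) != 0 ->
  - (- x / (1 - x)) / (1 - (- x / (1 - x))) = x.
Proof.
by move=> y0; rewrite pfaff_argument_one_sub// invrK mulNr divrK ?opprK.
Qed.

Lemma pfaff_argument_lt1 x : `|dre x| < 1 ->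
  (`|dre (- x / (1 - x))| < 1) = (dre x < 2^-1).
Proof.
move=> x1; have y0 : 0 < 1 - dre x.
  by rewrite subr_gt0; apply: le_lt_trans (ler_norm _) x1.
rewrite dreM dreV dreN dreB /= normrM normrN normfV (gtr0_norm y0).
rewrite ltr_pdivrMr// mul1r ltr_norml; apply/andP/idP => [[_ h]|h]; first by lra.
by move: x1; rewrite ltr_norml => /andP[? ?]; split; lra.
Qed.

(** For x between -1 and -1/2 the point z = -x/(1 - x) lies between 0 and 1/2.
    Since x |-> z is an involution, the transformation known at z is the
    transformation at x read backwards: no analytic continuation is needed. *)
Theorem pfaff a c b x : (forall i, dre b <> - i%:R) -> `|dre x| < 1 ->
  `|dre (- x / (1 - x))| < 1 ->
  gauss2F1 a c b x =
  dual_pow (1 - x) (- a) * gauss2F1 a (b - c) b (- x / (1 - x)).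
Proof.
move=> hb x1 z1; have [|x2] := ltP `|dre x| 2^-1; first by move=> ?; exact: pfaff_half.
have xlt : dre x < 2^-1 by rewrite -pfaff_argument_lt1.
have [xm1 xm2] : -1 < dre x /\ dre x <= - 2^-1.
  move: x1 x2; rewrite ltr_norml ler_normr => /andP[? ?] /orP[?|?]; split; lra.
have y0 : 0 < dre (1 - x) by rewrite dreB /=; lra.
have yn0 : dre (1 - x) != 0 by rewrite gt_eqF.
set z := - x / (1 - x) in z1 *.
have z2 : `|dre z| < 2^-1.
  rewrite /z dreM dreV dreN normrM normfV (gtr0_norm y0) ltr_pdivrMr//.
  by rewrite normrN ltr0_norm ?dreB /=; lra.
have zx : - z / (1 - z) = x by exact: pfaff_argument_involutive.
have := @pfaff_half a (b - c) b z hb z2; rewrite zx => /(_ x1) ->.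
rewrite /z pfaff_argument_one_sub// dual_powV// opprK.
have -> : b - (b - c) = c by ring.
by rewrite mulrA mulrC [X in _ * X]mulrC dual_powMN// mulr1.
Qed.

(** Pfaff's transformation twice, exchanging the two numerator parameters in
    between: the argument comes back to x. *)
Theorem euler a c b x : (forall i, dre b <> - i%:R) -> `|dre x| < 1 ->
  `|dre (- x / (1 - x))| < 1 ->
  gauss2F1 a c b x =
  dual_pow (1 - x) (b - a - c) * gauss2F1 (b - a) (b - c) b x.
Proof.
move=> hb x1 z1.
have y0 : 0 < dre (1 - x).
  by rewrite dreB subr_gt0; apply: le_lt_trans (ler_norm _) x1.
have yn0 : dre (1 - x) != 0 by rewrite gt_eqF.
have zK := pfaff_argument_involutive yn0.
have x1' : `|dre (- (- x / (1 - x)) / (1 - (- x / (1 - x))))| < 1 by rewrite zK.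
rewrite (pfaff a c hb x1 z1) gauss2F1C (pfaff (b - c) a hb z1 x1') zK.
rewrite pfaff_argument_one_sub// dual_powV// opprK mulrA -dual_powD//.
rewrite gauss2F1C.
by have -> : - a + (b - c) = b - a - c by ring.
Qed.

End DualGauss.

Theorem theorem7p2 (R : realType) (a1 a2 b1 x : dualnum R)
    (hb1 : forall n : nat, dre b1 <> - n%:R)
    (hx : dual_abs x < 1)
    (hx' : dual_abs (x / (1 - x)) < 1) :
  [/\ gauss_cvg a1 a2 b1 x,
      gauss_cvg a1 (b1 - a2) b1 (- x / (1 - x)),
      gauss_cvg (b1 - a1) (b1 - a2) b1 x,
      gauss2F1 a1 a2 b1 x =
        dual_pow (1 - x) (- a1) *
        gauss2F1 a1 (b1 - a2) b1 (- x / (1 - x))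
    & gauss2F1 a1 a2 b1 x =
        dual_pow (1 - x) (b1 - a1 - a2) *
        gauss2F1 (b1 - a1) (b1 - a2) b1 x].
Proof.
have x1 : `|dre x| < 1 by [].
have z1 : `|dre (- x / (1 - x))| < 1 by rewrite mulNr dreN normrN.
by split; [exact: gauss_summable..|exact: pfaff|exact: euler].
Qed.
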